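(* Let $M\subseteq P^m$, $P=\Bbbk[x_1,\dots,x_n]$, be a non-zero graded submodule, $H$ a homogeneous Pommaret basis of $M$ for a class respecting term order, and $d=\min_{h\in H}\mathrm{cls}\,h$. Then the projective dimension of $M$ is $\mathrm{proj\,dim}\,M=n-d$.
   Context: $\Bbbk$ is a field. Terms of $P^m$ are $x^\mu e_\alpha$ with $e_1,\dots,e_m$ the standard basis; the degree of $x^\mu e_\alpha$ is $|\mu|$. The class of $\mu\in\mathbb{N}_0^n$ is $\mathrm{cls}\,\mu=\min\{i\mid\mu_i\ne0\}$, with $\mathrm{cls}\,0=n$; the class of a term $x^\mu e_\alpha$ is $\mathrm{cls}\,\mu$, and $\mathrm{cls}\,f$ for $f\ne0$ is the class of its leading term. A term order $\prec$ on the terms of $P^m$ is class respecting if for terms of the same degree a smaller class implies being smaller with respect to $\prec$. The Pommaret cone of a term $x^\mu e_\alpha$ is $\{x^{\mu+\rho}e_\alpha\mid\rho\in\mathbb{N}_0^n,\ \rho_j=0\text{ for all }j>\mathrm{cls}\,\mu\}$. A Pommaret basis of $M$ for $\prec$ is a finite set $H\subset M\setminus\{0\}$ with pairwise distinct leading terms such that the set of all leading terms of non-zero elements of $M$ is the disjoint union of the Pommaret cones of the leading terms of the elements of $H$; it is homogeneous if all its elements are. The projective dimension of a graded module is the length of its minimal graded free resolution. *)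

(* Defs.v *)
From mathcomp Require Import all_boot all_order all_algebra.
From mathcomp.multinomials Require Import mpoly.

Set Implicit Arguments.
Unset Strict Implicit.
Unset Printing Implicit Defensive.

Import GRing.Theory.
Local Open Scope ring_scope.

(* The pair (mu, a) stands for x^mu e_a. *)
Notation term n m := ('X_{1..n} * 'I_m)%type.

Definition tmul (n m : nat) (r : 'X_{1..n}) (t : term n m) : term n m :=
  ((r + t.1)%MM, t.2).

(* Variables are indexed by 'I_n = {0, ..., n-1} but classes take values in
   {1, ..., n}, hence the i.+1.  The minimum over no index is n = cls 0. *)
Definition cls (n : nat) (mu : 'X_{1..n}) : nat :=
  \big[minn/n]_(i < n | mu i != 0%N) i.+1.

Definition tdeg (n m : nat) (t : term n m) : nat := mdeg t.1.
Definition tcls (n m : nat) (t : term n m) : nat := cls t.1.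

Definition pommaret_cone (n m : nat) (s t : term n m) : Prop :=
  exists2 rho : 'X_{1..n},
    (forall j : 'I_n, (tcls s < j.+1)%N -> rho j = 0%N) & t = tmul rho s.

Record term_order (n m : nat) (prec : rel (term n m)) : Prop := TermOrder {
  prec_irr : irreflexive prec;
  prec_trans : transitive prec;
  prec_total : forall s t, s != t -> prec s t || prec t s;
  prec_mul : forall r s t, prec s t -> prec (tmul r s) (tmul r t);
  prec_incr : forall r t, r != 0%MM -> prec t (tmul r t)
}.

Definition class_respecting (n m : nat) (prec : rel (term n m)) : Prop :=
  forall s t, tdeg s = tdeg t -> (tcls s < tcls t)%N -> prec s t.

Section FreeModule.

Variables (k : fieldType) (n m : nat).

Local Notation P := {mpoly k[n]}.
Local Notation Pm := 'rV[P]_m.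

Definition supp (f : Pm) : seq (term n m) :=
  [seq (mu, a) | a <- enum 'I_m, mu <- msupp (f 0 a)].

(* None exactly when f = 0 (for a term order). *)
Definition lead_term (prec : rel (term n m)) (f : Pm) : option (term n m) :=
  ohead [seq t <- supp f | all (fun s => (s == t) || prec s t) (supp f)].

(* The value at f = 0 is junk. *)
Definition fcls (prec : rel (term n m)) (f : Pm) : nat :=
  oapp (@tcls n m) n (lead_term prec f).

Definition vhomog (d : nat) (f : Pm) : Prop := forall a, f 0 a \is d.-homog.

Definition graded_submodule (M : {pred Pm}) : Prop :=
  GRing.submod_closed M /\
  forall f, f \in M -> forall d : nat, map_mx (pihomog mdeg d) f \in M.

Record pommaret_basis (prec : rel (term n m)) (M : {pred Pm}) (H : seq Pm) :
    Prop := PommaretBasis {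
  pb_sub : forall h, h \in H -> h \in M /\ h != 0;
  pb_uniq : uniq [seq lead_term prec h | h <- H];
  pb_cover : forall t : term n m,
    (exists f, [/\ f \in M, f != 0 & lead_term prec f = Some t]) <->
    (exists h s, [/\ h \in H, lead_term prec h = Some s & pommaret_cone s t]);
  pb_disjoint : forall h1 h2 s1 s2 t, h1 \in H -> h2 \in H -> h1 != h2 ->
    lead_term prec h1 = Some s1 -> lead_term prec h2 = Some s2 ->
    ~ (pommaret_cone s1 t /\ pommaret_cone s2 t)
}.

Definition homogeneous_set (H : seq Pm) : Prop :=
  forall h, h \in H -> exists d, vhomog d h.

(* Classes are at most n, so the neutral element n does not affect the minimum
   of a nonempty H. *)
Definition min_cls (prec : rel (term n m)) (H : seq Pm) : nat :=
  \big[minn/n]_(h <- H) fcls prec h.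

(* Data of a sequence ... -> F_1 -> F_0 -> P^m of free modules of finite rank.
   Linear maps act on row vectors by v |-> v *m D; the generator a of F_i has
   degree gdeg i a, i.e. F_i is the direct sum of the P(- gdeg i a). *)
Record free_seq := FreeSeq {
  rank : nat -> nat;
  gdeg : forall i, 'I_(rank i) -> int;
  diff : forall i, 'M[P]_(rank i.+1, rank i);
  aug : 'M[P]_(rank 0, m)
}.

(* The maps are homogeneous of degree 0, where e_1, ..., e_m have degree 0. *)
Definition graded_maps (F : free_seq) : Prop :=
  (forall (a : 'I_(rank F 0)) (b : 'I_m) (mu : 'X_{1..n}),
     mu \in msupp (aug F a b) -> (mdeg mu)%:Z = gdeg a) /\
  (forall i (a : 'I_(rank F i.+1)) (b : 'I_(rank F i)) (mu : 'X_{1..n}),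
     mu \in msupp (diff F i a b) -> gdeg b + (mdeg mu)%:Z = gdeg a).

Record graded_free_resolution (M : {pred Pm}) (F : free_seq) : Prop :=
    GradedFreeResolution {
  res_graded : graded_maps F;
  res_image : forall f : Pm, f \in M <-> exists v : 'rV_(rank F 0), f = v *m aug F;
  res_exact0 : forall v : 'rV_(rank F 0),
    v *m aug F = 0 <-> exists w : 'rV_(rank F 1), v = w *m diff F 0;
  res_exactS : forall i (v : 'rV_(rank F i.+1)),
    v *m diff F i = 0 <-> exists w : 'rV_(rank F i.+2), v = w *m diff F i.+1
}.

(* The image of F_(i+1) lies in (x_1, ..., x_n) F_i: all components of its
   elements have zero constant term. *)
Definition minimal (F : free_seq) : Prop :=
  forall i (v : 'rV_(rank F i.+1)) b, ((v *m diff F i) 0 b)@_0%MM = 0.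

Definition res_length (F : free_seq) (l : nat) : Prop :=
  (0 < rank F l)%N /\ forall i, (l < i)%N -> rank F i = 0%N.

(* Minimal graded free resolutions are unique only up to isomorphism, so all of
   them are required to have length l. *)
Definition proj_dim (M : {pred Pm}) (l : nat) : Prop :=
  (exists F, graded_free_resolution M F /\ minimal F) /\
  (forall F, graded_free_resolution M F -> minimal F -> res_length F l).

End FreeModule.

(* Main.v *)
(* For s <= n let I_s = (x_1, ..., x_s) and let d be the minimal class in H.

   Reducing leading terms by H shows that, for s < d, a homogeneous element of M
   lying in I_s P^m already lies in I_s M; hence x_1, ..., x_d is a regular
   sequence on M.  The same reduction, together with the class respecting order,
   shows that an element h of H of class d and maximal degree satisfies
   x_j h in I_d M for all j > d, whereas h is not in I_d M because the Pommaret
   cones are disjoint: h is a socle element of M / I_d M.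

   Let F be a minimal graded free resolution of M.  Adding one variable at a
   time, F / I_s F is exact at F_i for i > max(0, s - d), and the socle element
   propagates to a class in the homology of F / I_s F at F_(s-d), d <= s <= n.
   For s = n all differentials vanish, so F_i = 0 for i > n - d and F_(n-d) is
   not 0.

   Minimal resolutions exist since, by Dickson's lemma, graded submodules have
   finite minimal systems of homogeneous generators. *)
From Stdlib Require Import Classical IndefiniteDescription.
Require Import Defs.
From mathcomp Require Import all_boot all_order all_algebra.
From mathcomp.multinomials Require Import mpoly.

Set Implicit Arguments.
Unset Strict Implicit.
Unset Printing Implicit Defensive.

Import Order.TTheory GRing.Theory.
Local Open Scope ring_scope.

(** * Subsequences of natural numbers and Dickson's lemma *)

Lemma nat_min (Q : nat -> Prop) :
  (exists q, Q q) -> exists2 q, Q q & forall p, (p < q)%N -> ~ Q p.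
Proof.
case=> q; elim/ltn_ind: q => q IH Qq.
case: (classic (exists2 p, (p < q)%N & Q p)) => [[p lt_pq Qp]|no].
  exact: IH lt_pq Qp.
by exists q => // p lt_pq Qp; apply: no; exists p.
Qed.

Lemma argmin_from (u : nat -> nat) (k : nat) :
  exists2 p, (k <= p)%N & forall q, (k <= q)%N -> (u p <= u q)%N.
Proof.
have [|v [p le_kp up] min_v] :=
    @nat_min (fun v => exists2 p, (k <= p)%N & u p = v).
  by exists (u k), k.
exists p => // q le_kq; rewrite up leqNgt; apply/negP => lt_qv.
by apply: (min_v _ lt_qv); exists q.
Qed.

(** Each index is chosen to minimise [u] on the tail after the previous index, so no later value can
    be smaller. *)
Lemma nondecreasing_subseq (u : nat -> nat) :
  exists2 phi : nat -> nat, {homo phi : p q / (p < q)%N} &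
    {homo u \o phi : p q / (p < q)%N >-> (p <= q)%N}.
Proof.
have [g gP] := functional_choice
  (fun k p => (k <= p)%N /\ forall q, (k <= q)%N -> (u p <= u q)%N)
  (fun k => let: ex_intro2 p a b := argmin_from u k in
            ex_intro _ p (conj a b)).
pose phi := fix phi i := if i is j.+1 then g (phi j).+1 else g 0%N.
have phi_lt i : (phi i < phi i.+1)%N by case: (gP (phi i).+1).
have phi_inc : {homo phi : p q / (p < q)%N}.
  exact: homo_ltn ltn_trans phi_lt.
exists phi => // p q /phi_inc lt_pq /=.
case: p lt_pq => [|p] lt_pq; first by apply: (gP 0%N).2.
by apply: (gP (phi p).+1).2; apply: leq_trans (phi_lt p) (ltnW lt_pq).
Qed.

Lemma common_nondecreasing_subseq (I : eqType) (u : I -> nat -> nat)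
    (s : seq I) :
  exists2 phi : nat -> nat, {homo phi : p q / (p < q)%N} &
    {in s, forall i, {homo u i \o phi : p q / (p < q)%N >-> (p <= q)%N}}.
Proof.
elim: s => [|i s [phi phi_inc phiP]]; first by exists id.
have [psi psi_inc psiP] := nondecreasing_subseq (u i \o phi).
exists (phi \o psi); first by move=> p q /psi_inc /phi_inc.
move=> j; rewrite inE => /predU1P [-> //|/phiP Hj] p q /psi_inc.
exact: Hj.
Qed.

Lemma dickson (n r : nat) (t : nat -> term n r) :
  exists i j rho, (i < j)%N /\ t j = tmul rho (t i).
Proof.
(* The position enters both as [t.2] and as [r - t.2]; if neither decreases, the position stays the
   same. *)
pose u (c : 'I_n + bool) k := match c with
  inl i => (t k).1 i | inr b => if b then val (t k).2 else (r - (t k).2)%N end.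
have [phi phi_inc phiP] :=
  common_nondecreasing_subseq u (enum {: 'I_n + bool}).
exists (phi 0%N), (phi 1%N), ((t (phi 1%N)).1 - (t (phi 0%N)).1)%MM.
split; first exact: phi_inc.
have le c : (u c (phi 0%N) <= u c (phi 1%N))%N.
  by apply: (phiP c) => //; rewrite mem_enum.
rewrite /tmul [LHS]surjective_pairing; congr pair.
  by rewrite submK //; apply/mnm_lepP => i; apply: (le (inl i)).
apply: val_inj; apply/eqP; rewrite eqn_leq (le (inr true)) andbT.
by have := le (inr false); rewrite /u /= leq_sub2lE // ltnW.
Qed.

(** * Term orders *)

Section TermOrder.

Variables (n r : nat) (prec : rel (term n r)).
Hypothesis ord : term_order prec.

Lemma tmul0 (t : term n r) : tmul 0%MM t = t.
Proof. by case: t => mu a; rewrite /tmul add0m. Qed.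

Lemma prec_asym s t : prec s t -> prec t s -> False.
Proof.
by move=> st ts; have := prec_trans ord st ts; rewrite (prec_irr ord).
Qed.

(** Along an infinite descending chain [dickson] would give a later term that is a multiple of an
    earlier one, but by [prec_incr] a multiple is never smaller. *)
Lemma prec_wf : well_founded prec.
Proof.
move=> t0; apply: NNPP => nAcc.
have step t : exists s, ~ Acc prec t -> prec s t /\ ~ Acc prec s.
  case: (classic (Acc prec t)) => [a|na]; first by exists t.
  apply: NNPP => H; apply: na; constructor => s st; apply: NNPP => ns.
  by apply: H; exists s.
have [g gP] := functional_choice _ step.
pose u i := iter i g t0.
have nu i : ~ Acc prec (u i) by elim: i => //= i /gP [].
have dec : {homo u : p q / (p < q)%N >-> prec q p}.
  apply: homo_ltn => [y x z xy yz|i]; first exact: (prec_trans ord) yz xy.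
  by case: (gP _ (nu i)).
have [i [j [rho [lt_ij E]]]] := dickson u.
have := dec _ _ lt_ij; rewrite E.
have [->|nz] := eqVneq rho 0%MM; first by rewrite tmul0 (prec_irr ord).
by move/(prec_asym (prec_incr ord _ nz)).
Qed.

Lemma seq_max (s0 : term n r) (l : seq (term n r)) :
  exists2 t, t \in s0 :: l &
    forall s, s \in s0 :: l -> s != t -> prec s t.
Proof.
elim: l s0 => [|s1 l IH] s0.
  by exists s0; rewrite ?inE // => s; rewrite inE => ->.
have [t tl tP] := IH s1.
have [->|ne] := eqVneq s0 t.
  exists t; rewrite ?inE ?eqxx // => s; rewrite inE => /predU1P [->|/tP //].
  by rewrite eqxx.
case/orP: (prec_total ord ne) => [lt|gt].
  exists t; first by rewrite inE tl orbT.
  by move=> s; rewrite inE => /predU1P [->|/tP].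
exists s0; rewrite ?inE ?eqxx // => s; rewrite inE.
case/predU1P => [->|sl _]; first by rewrite eqxx.
have [-> //|/(tP _ sl) st] := eqVneq s t.
exact: (prec_trans ord) st gt.
Qed.

End TermOrder.

(* Term over position; finite generation needs a term order on each F_i. *)
Definition top_order (n r : nat) : rel (term n r) := fun s t =>
  (s.1 < t.1)%O || (s.1 == t.1) && (s.2 < t.2)%N.

Lemma top_orderP (n r : nat) : term_order (@top_order n r).
Proof.
split; rewrite /top_order.
- by move=> t; rewrite ltxx ltnn andbF.
- move=> t s u /= /orP [lt1|/andP [/eqP-> lt1]] /orP [lt2|/andP [/eqP E lt2]].
  + by rewrite (lt_trans lt1 lt2).
  + by rewrite -E lt1.
  + by rewrite lt2.
  + by rewrite E eqxx (ltn_trans lt1 lt2) orbT.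
- move=> [m1 a1] [m2 a2] /=; rewrite xpair_eqE negb_and.
  have [->|ne _] := eqVneq m1 m2; last first.
    by move: ne; rewrite neq_lt !andFb !orbF.
  by rewrite ltxx /= -val_eqE neq_ltn.
- move=> rho [m1 a1] [m2 a2] /=; rewrite ltmc_add2r.
  by rewrite eqm_add2l.
- move=> rho [m1 a1] nz /=; apply/orP; left.
  rewrite lt_neqAle lemc_addl andbT -{1}[m1]add0m eqm_add2r.
  by rewrite eq_sym.
Qed.

(** * Coefficients and leading terms of vectors of polynomials *)

Section Coefficients.

Variables (k : fieldType) (n r : nat).
Implicit Types (f g : 'rV[{mpoly k[n]}]_r) (s t : term n r) (mu : 'X_{1..n}).

Definition vcoef f t : k := (f 0 t.2)@_t.1.

Lemma vcoefP f g : vcoef f =1 vcoef g -> f = g.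
Proof.
move=> fg; apply/rowP => a; apply/mpolyP => mu; exact: (fg (mu, a)).
Qed.

Lemma vcoef0 t : vcoef 0 t = 0.
Proof. by rewrite /vcoef mxE mcoeff0. Qed.

Lemma vcoefD f g t : vcoef (f + g) t = vcoef f t + vcoef g t.
Proof. by rewrite /vcoef mxE mcoeffD. Qed.

Lemma vcoefN f t : vcoef (- f) t = - vcoef f t.
Proof. by rewrite /vcoef mxE mcoeffN. Qed.

Lemma vcoefB f g t : vcoef (f - g) t = vcoef f t - vcoef g t.
Proof. by rewrite vcoefD vcoefN. Qed.

Lemma vcoefC c f t : vcoef (c%:MP *: f) t = c * vcoef f t.
Proof. by rewrite /vcoef mxE mcoeffCM. Qed.

Lemma vcoefXM mu f t : vcoef ('X_[mu] *: f) (tmul mu t) = vcoef f t.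
Proof. by rewrite /vcoef mxE mulrC mcoeffMX. Qed.

Lemma vcoefXM_n0 mu f t : vcoef ('X_[mu] *: f) t != 0 ->
  exists2 s, t = tmul mu s & vcoef f s != 0.
Proof.
case: t => nu a; rewrite /vcoef mxE /= mulrC -mcoeff_msupp.
rewrite (perm_mem (msuppMX _ _)) => /mapP [nu' Hnu ->].
by exists (nu', a); rewrite // -mcoeff_msupp.
Qed.

Lemma vcoef_sum (I : Type) (s : seq I) (Q : pred I) (F : I -> _) t :
  vcoef (\sum_(i <- s | Q i) F i) t = \sum_(i <- s | Q i) vcoef (F i) t.
Proof.
elim/big_ind2: _ => // [|f1 c1 f2 c2 <- <-]; first exact: vcoef0.
exact: vcoefD.
Qed.

Lemma rV_ind (Q : 'rV[{mpoly k[n]}]_r -> Prop) :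
  Q 0 -> (forall f g, Q f -> Q g -> Q (f + g)) ->
  (forall c mu a, Q (c%:MP *: ('X_[mu] *: delta_mx 0 a))) -> forall f, Q f.
Proof.
move=> Q0 QD QX f; rewrite (row_sum_delta f); apply: (big_ind Q) => // a _.
rewrite {1}(mpolyE (f 0 a)) scaler_suml; apply: (big_ind Q) => // mu _.
by rewrite -mul_mpolyC -scalerA.
Qed.

Lemma mem_supp f t : (t \in supp f) = (vcoef f t != 0).
Proof.
rewrite /vcoef -mcoeff_msupp; apply/allpairsPdep/idP => [[a [mu [_ H ->]]] //|].
by case: t => mu a H; exists a, mu; rewrite mem_enum.
Qed.

Section Leading.

Variable prec : rel (term n r).
Hypothesis ord : term_order prec.

(** Relational counterpart of [lead_term], linked to it by [lead_termP]. *)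
Definition is_lt f t : Prop :=
  vcoef f t != 0 /\ forall s, vcoef f s != 0 -> s != t -> prec s t.

Lemma is_lt_uniq f s t : is_lt f s -> is_lt f t -> s = t.
Proof.
move=> [s0 sm] [t0 tm]; apply/eqP/negP => /negP ne.
by apply: (prec_asym ord (sm _ t0 _) (tm _ s0 ne)); rewrite eq_sym.
Qed.

Lemma is_lt_ex f : f != 0 -> exists t, is_lt f t.
Proof.
case E: (supp f) => [|t0 l] nz.
  case/eqP: nz; apply: vcoefP => t; rewrite vcoef0; apply/eqP/negPn.
  by rewrite -mem_supp E.
have [t tl tP] := seq_max ord t0 l; exists t; split.
  by rewrite -mem_supp E.
by move=> s; rewrite -mem_supp E; apply: tP.
Qed.

Lemma lead_termP f t : lead_term prec f = Some t <-> is_lt f t.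
Proof.
rewrite /lead_term.
have mem s : s \in [seq t <- supp f | all (fun s => (s == t) || prec s t)
                     (supp f)] <-> is_lt f s.
  rewrite mem_filter mem_supp; split.
    case/andP => /allP H nz; split=> // u; rewrite -mem_supp => /H.
    by case: eqP.
  case=> -> H; rewrite andbT; apply/allP => u; rewrite mem_supp => /H.
  by case: eqP => //= _; apply.
case E: [seq t <- _ | _] mem => [|t0 l] mem /=; split=> //.
- by move/mem.
- by case=> <-; apply/mem; rewrite inE eqxx.
move=> Ht; congr Some; apply: is_lt_uniq Ht; apply/mem.
by rewrite inE eqxx.
Qed.

Lemma is_ltXM mu f t : is_lt f t -> is_lt ('X_[mu] *: f) (tmul mu t).
Proof.
case=> nz tm; split; first by rewrite vcoefXM.
move=> s /vcoefXM_n0 [u -> /tm H] ne; apply: (prec_mul ord); apply: H.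
by apply: contraNneq ne => ->.
Qed.

(** The quotient of the leading coefficients cancels [t]; every other term of the difference occurs
    in [f] or in [g], hence lies below [t]. *)
Lemma is_lt_cancel f g t : is_lt f t -> is_lt g t ->
  exists c, forall s, is_lt (f - c%:MP *: g) s -> prec s t.
Proof.
move=> [f0 fm] [g0 gm]; exists (vcoef f t / vcoef g t) => s [].
rewrite vcoefB vcoefC.
have [->|ne] := eqVneq s t; first by rewrite divfK // subrr eqxx.
have [/eqP Ef|/fm H _ _] := boolP (vcoef f s == 0); last exact: H.
have [/eqP Eg|/gm H _ _] := boolP (vcoef g s == 0); last exact: H.
by rewrite Ef Eg mulr0 subrr eqxx.
Qed.

End Leading.

(** * Gradings of free modules with shifted generators *)

Section Weights.

Variable w : 'I_r -> nat.

Definition wdeg t : nat := (mdeg t.1 + w t.2)%N.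

Definition whomog e f : Prop := forall t, vcoef f t != 0 -> wdeg t = e.

(** The test guards against truncated subtraction: for [e < w a], [e - w a] is 0 and would select a
    constant term. *)
Definition wcomp e f : 'rV[{mpoly k[n]}]_r :=
  \row_a (if (w a <= e)%N then pihomog mdeg (e - w a) (f 0 a) else 0).

Lemma mcoeff_pihomog e (p : {mpoly k[n]}) mu :
  (pihomog mdeg e p)@_mu = if mdeg mu == e then p@_mu else 0.
Proof.
rewrite pihomogE raddf_sum /=; under eq_bigr do rewrite mcoeffZ mcoeffX.
case: ifP => He; last first.
  apply: big1 => nu /eqP E; case: eqP => [Enu|]; last by rewrite mulr0.
  by move: He; rewrite -Enu E eqxx.
rewrite [in RHS](mpolyE p) raddf_sum /=.
under [in RHS]eq_bigr do rewrite mcoeffZ mcoeffX.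
rewrite big_mkcond; apply: eq_bigr => nu _; case: ifP => // H.
by case: eqP => [E|]; rewrite ?mulr0 //; move: H; rewrite E He.
Qed.

Lemma vcoef_wcomp e f t :
  vcoef (wcomp e f) t = if wdeg t == e then vcoef f t else 0.
Proof.
rewrite /vcoef mxE /wdeg; case: leqP => le; last first.
  by rewrite mcoeff0; case: eqP => // E; move: le; rewrite -E ltnNge leq_addl.
by rewrite mcoeff_pihomog -(eqn_add2r (w t.2)) subnK.
Qed.

Lemma wcomp_homog e f : whomog e (wcomp e f).
Proof.
by move=> t; rewrite vcoef_wcomp; case: (wdeg t =P e) => // _; rewrite eqxx.
Qed.

Lemma wcomp_id e f : whomog e f -> wcomp e f = f.
Proof.
move=> H; apply: vcoefP => t; rewrite vcoef_wcomp; case: eqP => // ne.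
by apply/esym/eqP/negPn/negP => /H.
Qed.

Lemma wcomp_other e d f : whomog d f -> d != e -> wcomp e f = 0.
Proof.
move=> H ne; apply: vcoefP => t; rewrite vcoef_wcomp vcoef0.
case: eqP => // E; apply/eqP/negPn/negP => /H; rewrite E => /eqP.
by rewrite eq_sym (negPf ne).
Qed.

Lemma wcompD e f g : wcomp e (f + g) = wcomp e f + wcomp e g.
Proof.
apply: vcoefP => t; rewrite vcoefD !vcoef_wcomp vcoefD.
by case: eqP; rewrite ?addr0.
Qed.

Lemma wcomp0 e : wcomp e 0 = 0.
Proof. by apply: vcoefP => t; rewrite vcoef_wcomp vcoef0 if_same. Qed.

Lemma wcomp_sum f :
  exists B, f = \sum_(e < B) wcomp e f.
Proof.
exists (\max_(t <- supp f) wdeg t).+1; apply: vcoefP => t; rewrite vcoef_sum.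
rewrite (eq_bigr _ (fun (e : 'I__) _ => vcoef_wcomp e f t)).
have [/eqP ->|nz] := boolP (vcoef f t == 0).
  by rewrite big1 // => e _; rewrite if_same.
have lt : (wdeg t < (\max_(t <- supp f) wdeg t).+1)%N.
  by rewrite ltnS; apply: leq_bigmax_seq; rewrite ?mem_supp.
rewrite (bigD1 (Ordinal lt)) //= eqxx big1 ?addr0 // => e.
by rewrite -val_eqE /= eq_sym => /negPf ->.
Qed.

Lemma whomogB e f g : whomog e f -> whomog e g -> whomog e (f - g).
Proof.
move=> Hf Hg t; rewrite vcoefB.
have [/eqP ->|/Hf //] := boolP (vcoef f t == 0).
by rewrite sub0r oppr_eq0 => /Hg.
Qed.

Lemma whomogC e c f : whomog e f -> whomog e (c%:MP *: f).
Proof. by move=> H t; rewrite vcoefC mulf_eq0 negb_or => /andP [_ /H]. Qed.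

Lemma whomogXM e mu f : whomog e f -> whomog (mdeg mu + e) ('X_[mu] *: f).
Proof.
by move=> H t /vcoefXM_n0 [s -> /H <-]; rewrite /wdeg mdegD addnA.
Qed.

Lemma wcompXM e mu f :
  wcomp (mdeg mu + e) ('X_[mu] *: f) = 'X_[mu] *: wcomp e f.
Proof.
rewrite {1}(_ : f = wcomp e f + (f - wcomp e f)); last by rewrite addrC subrK.
rewrite scalerDr wcompD wcomp_id; last exact/whomogXM/wcomp_homog.
rewrite [X in _ + X](_ : _ = 0) ?addr0 //.
apply: vcoefP => t; rewrite vcoef_wcomp vcoef0; case: eqP => // E.
apply/eqP/negPn/negP => /vcoefXM_n0 [s Et].
rewrite vcoefB vcoef_wcomp.
case: (wdeg s =P e) => [_|[]]; first by rewrite subrr eqxx.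
apply/eqP; rewrite -(eqn_add2l (mdeg mu)) -E Et /wdeg.
by rewrite mdegD addnA.
Qed.

End Weights.

(** * Finite generation of submodules *)

Section Submodules.

Definition submod (N : 'rV[{mpoly k[n]}]_r -> Prop) : Prop :=
  N 0 /\ forall p f g, N f -> N g -> N (p *: f + g).

Lemma submodD N f g : submod N -> N f -> N g -> N (f + g).
Proof. by case=> _ H Nf Ng; rewrite -[f]scale1r; apply: H. Qed.

Lemma submodZ N p f : submod N -> N f -> N (p *: f).
Proof. by case=> N0 H Nf; rewrite -[_ *: _]addr0; apply: H. Qed.

Lemma submodB N f g : submod N -> N f -> N g -> N (f - g).
Proof. by move=> sN Nf Ng; rewrite -scaleN1r addrC; apply: sN.2. Qed.

Lemma submod_sum N (I : Type) (s : seq I) (Q : pred I) (F : I -> _) :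
  submod N -> (forall i, Q i -> N (F i)) -> N (\sum_(i <- s | Q i) F i).
Proof.
move=> sN NF; apply: (big_ind N) => //; first exact: sN.1.
by move=> f g; apply: submodD.
Qed.

Definition span (gs : seq 'rV[{mpoly k[n]}]_r) f : Prop :=
  forall N, submod N -> (forall g, g \in gs -> N g) -> N f.

Lemma span_submod gs : submod (span gs).
Proof.
split=> [N [] //|p f g sf sg N sN gsN].
by apply: sN.2; [apply: sf | apply: sg].
Qed.

Lemma mem_span gs g : g \in gs -> span gs g.
Proof. by move=> gin N _; apply. Qed.

(** Otherwise one can repeatedly choose an element of [N] outside the span of the previous choices,
    with smallest possible leading term. By [dickson] a later leading term is a multiple of an
    earlier one; cancelling it leaves an element still outside the span with a smaller leading
    term. *)
Lemma noetherian N : submod N ->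
  exists2 gs, (forall g, g \in gs -> N g) & forall f, N f -> span gs f.
Proof.
move=> sN; apply: NNPP => nfg.
pose prec := @top_order n r; have ord : term_order prec := @top_orderP n r.
have nz gs g : ~ span gs g -> g != 0.
  by move=> ng; apply/eqP => g0; apply: ng; rewrite g0; case: (span_submod gs).
have step gs : exists f, (forall g, g \in gs -> N g) ->
    [/\ N f, ~ span gs f & exists2 t, is_lt prec f t &
      forall g s, N g -> ~ span gs g -> is_lt prec g s -> ~ prec s t].
  case: (classic (forall g, g \in gs -> N g)) => [gsN|no]; last by exists 0.
  have [f [Nf nf]] : exists f, N f /\ ~ span gs f.
    apply: NNPP => no; apply: nfg; exists gs => // f Nf.
    by apply: NNPP => nf; apply: no; exists f.
  have [t] := is_lt_ex ord (nz _ _ nf).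
  elim/(well_founded_ind (prec_wf ord)): t f Nf nf => t IH f Nf nf ft.
  case: (classic (exists g s,
      [/\ N g, ~ span gs g, is_lt prec g s & prec s t])).
    by case=> g [s [Ng ng gs_lt st]]; apply: IH st g Ng ng gs_lt.
  move=> no; exists f => _; split=> //; exists t => // g s Ng ng gs_lt st.
  by apply: no; exists g, s.
have [F FP] := functional_choice _ step.
pose L := fix L i := if i is j.+1 then F (L j) :: L j else [::].
have LN i : forall g, g \in L i -> N g.
  elim: i => //= i IH g; rewrite inE => /predU1P [->|/IH //].
  by case: (FP _ IH).
have Lmem i j : (i < j)%N -> F (L i) \in L j.
  elim: j => //= j IH; rewrite ltnS leq_eqVlt inE.
  by case/predU1P => [->|/IH ->]; rewrite ?eqxx ?orbT.
have [T TP] := functional_choice (fun i t => is_lt prec (F (L i)) t /\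
    forall g s, N g -> ~ span (L i) g -> is_lt prec g s -> ~ prec s t)
  (fun i => let: And3 _ _ (ex_intro2 t a b) := FP _ (LN i) in
            ex_intro _ t (conj a b)).
have [i [j [rho [lt_ij E]]]] := dickson T.
have [NFi _ _] := FP _ (LN i); have [NFj nFj _] := FP _ (LN j).
have [lti _] := TP i; have [ltj minj] := TP j.
have lti' := is_ltXM ord rho lti; rewrite -E in lti'.
have [c cP] := is_lt_cancel ltj lti'.
set g := _ - _ in cP.
have Ng : N g by apply: submodB => //; do 2 apply: submodZ => //.
have ng : ~ span (L j) g.
  move=> sg; apply: nFj; rewrite -[F _](subrK (c%:MP *: ('X_[rho] *: F (L i)))).
  apply: submodD (span_submod _) sg _; do 2 apply: submodZ (span_submod _) _.
  exact: mem_span (Lmem _ _ lt_ij).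
have [s gs] := is_lt_ex ord (nz _ _ ng).
exact: minj Ng ng gs (cP _ gs).
Qed.

End Submodules.

End Coefficients.

(** * Minimal systems of homogeneous generators *)

Section MinimalGenerators.

Variables (k : fieldType) (n : nat).
Local Notation P := {mpoly k[n]}.

Definition wgraded (r : nat) (w : 'I_r -> nat) (N : 'rV[P]_r -> Prop) : Prop :=
  forall f, N f -> forall e, N (wcomp w e f).

Definition whomog_rows (q r : nat) (w : 'I_r -> nat) (D : 'M[P]_(q, r))
    (w' : 'I_q -> nat) : Prop :=
  forall i, whomog w (w' i) (row i D).

Lemma wcomp_mul (q r : nat) (w : 'I_r -> nat) (D : 'M[P]_(q, r)) w' e v :
  whomog_rows w D w' -> wcomp w e (v *m D) = wcomp w' e v *m D.
Proof.
move=> hD; elim/rV_ind: v => [|f g IHf IHg|c mu a].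
- by rewrite wcomp0 !mul0mx wcomp0.
- by rewrite wcompD !mulmxDl wcompD IHf IHg.
have hX : whomog w' (mdeg mu + w' a) (c%:MP *: ('X_[mu] *: delta_mx 0 a)).
  apply/whomogC/whomogXM => -[nu b]; rewrite /vcoef mxE eqxx /= /wdeg /=.
  have [->|_] := eqVneq b a; last by rewrite mcoeff0 eqxx.
  by rewrite mcoeff1; have [->|_] := eqVneq nu 0%MM; rewrite ?mdeg0 ?eqxx.
have hXD : whomog w (mdeg mu + w' a)
    ((c%:MP *: ('X_[mu] *: delta_mx 0 a)) *m D).
  by rewrite -!scalemxAl -rowE; apply/whomogC/whomogXM/hD.
have [E|ne] := eqVneq (mdeg mu + w' a)%N e.
  by rewrite -E !wcomp_id.
by rewrite (wcomp_other hX ne) (wcomp_other hXD ne) mul0mx.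
Qed.

Lemma wgraded_kernel (q r : nat) (w : 'I_r -> nat) (D : 'M[P]_(q, r)) w' :
  whomog_rows w D w' -> wgraded w' (fun v => v *m D = 0).
Proof. by move=> hD f f0 e; rewrite -(wcomp_mul _ _ hD) f0 wcomp0. Qed.

Lemma submod_kernel (q r : nat) (D : 'M[P]_(q, r)) :
  submod (fun v => v *m D = 0).
Proof.
split=> [|p f g f0 g0]; first exact: mul0mx.
by rewrite mulmxDl -scalemxAl f0 g0 scaler0 addr0.
Qed.

Definition homogeneous_gens (r : nat) (w : 'I_r -> nat) (N : 'rV[P]_r -> Prop)
    (q : nat) : Prop :=
  exists (D : 'M[P]_(q, r)) (w' : 'I_q -> nat), whomog_rows w D w' /\
    forall f, N f <-> exists v, f = v *m D.

(** The homogeneous components of finitely many generators generate as well, and they lie in [N]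
    because [N] is graded. *)
Lemma homogeneous_gens_ex (r : nat) (w : 'I_r -> nat) (N : 'rV[P]_r -> Prop) :
  submod N -> wgraded w N -> exists q, homogeneous_gens w N q.
Proof.
move=> sN gN; have [gs gsN gsP] := noetherian sN.
have [B BP] := @functional_choice _ _ (fun f B => f = \sum_(e < B) wcomp w e f)
  (@wcomp_sum k n r w).
(* Degrees are stored along with the components, since a zero component does not determine its
   degree. *)
pose hs := [seq (e, wcomp w e g) | g <- gs, e <- iota 0 (B g)].
have hsP i : (i < size hs)%N -> let x := nth (0%N, 0) hs i in
    N x.2 /\ whomog w x.1 x.2.
  move/(mem_nth (0%N, 0)) => /allpairsPdep [g [e [gin _ ->]]] /=.
  by split; [apply/gN/gsN | apply: wcomp_homog].
exists (size hs), (\matrix_(i < size hs) (nth (0%N, 0) hs i).2),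
  (fun i => (nth (0%N, 0) hs i).1); split.
  by move=> i; rewrite rowK; case: (hsP i).
move=> f; split; last first.
  case=> v ->; rewrite mulmx_sum_row; apply: submod_sum => // i _.
  by apply: submodZ => //; rewrite rowK; case: (hsP i).
set D := \matrix_i _ => Nf.
pose Img (f : 'rV_r) := exists v, f = v *m D; have sD : submod Img.
  split=> [|p f1 f2 [v1 ->] [v2 ->]]; first by exists 0; rewrite mul0mx.
  by exists (p *: v1 + v2); rewrite mulmxDl scalemxAl.
apply: (gsP f Nf Img sD) => g gin.
rewrite -/(Img g) (BP g); apply: (@submod_sum k n r Img _ _ _ _ sD) => e _.
have: (val e, wcomp w e g) \in hs.
  by apply/allpairsPdep; exists g, (val e); rewrite mem_iota /= add0n ltn_ord.
case/(nthP (0%N, 0)) => i lt_i E.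
exists (delta_mx 0 (Ordinal lt_i)); rewrite -rowE rowK.
by rewrite [nth _ _ _]E.
Qed.

(** A relation with a non-zero constant coefficient at [i] would express row [i] through the other
    rows, leaving one generator fewer. *)
Lemma minimal_gens_kernel (q r : nat) (w : 'I_r -> nat) (N : 'rV[P]_r -> Prop)
    (D : 'M[P]_(q, r)) (w' : 'I_q -> nat) :
  whomog_rows w D w' -> (forall f, N f <-> exists v, f = v *m D) ->
  (forall p, (p < q)%N -> ~ homogeneous_gens w N p) ->
  forall (v : 'rV_q) i, v *m D = 0 -> (v 0 i)@_0%MM = 0.
Proof.
case: q D w' => [D w' _ _ _ v []//|q D w' hD ND qmin v i v0].
apply/eqP/negPn/negP => nz; apply: (qmin q) => //.
(* In the component of degree [w' i] the entry at [i] is exactly this constant, hence a unit. *)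
have := wgraded_kernel hD v0 (w' i); set u := wcomp _ _ _ => u0.
have ui : u 0 i = ((v 0 i)@_0%MM)%:MP.
  apply/mpolyP => mu; have := vcoef_wcomp w' (w' i) v (mu, i).
  rewrite /vcoef /wdeg /= => ->; rewrite mcoeffC -{2}[w' i]add0n eqn_add2r.
  rewrite mdeg_eq0; case: eqP => [->|_]; first by rewrite mulr1.
  by rewrite mulr0.
have [y Dy] : exists y, row i D = y *m row' i D.
  exists (\row_j (- ((((v 0 i)@_0%MM)^-1)%:MP * u 0 (lift i j)))).
  move: u0; rewrite !mulmx_sum_row (bigD1_ord i) //= ui.
  move/(congr1 (fun x => (((v 0 i)@_0%MM)^-1)%:MP *: x)).
  rewrite scaler0 scalerDr scalerA -mpolyCM mulVf // scale1r.
  move/eqP; rewrite addr_eq0 => /eqP ->; rewrite scaler_sumr -sumrN.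
  apply: eq_bigr => j _; rewrite [in RHS]mxE scaleNr scalerA.
  congr (- (_ *: _)).
  by apply/rowP => a; rewrite !mxE.
exists (row' i D), (fun j => w' (lift i j)); split.
  move=> j; rewrite (_ : row j _ = row (lift i j) D) //.
  by apply/rowP => a; rewrite !mxE.
move=> f; rewrite ND; split=> [[x ->]|[x ->]].
  exists (x 0 i *: y + \row_j x 0 (lift i j)).
  rewrite mulmxDl -scalemxAl -Dy !mulmx_sum_row (bigD1_ord i) //=.
  congr (_ + _).
  apply: eq_bigr => j _; rewrite mxE; congr (_ *: _).
  by apply/rowP => a; rewrite !mxE.
exists (\row_j if unlift i j is Some j' then x 0 j' else 0).
rewrite [RHS]mulmx_sum_row (bigD1_ord i) //= mxE unlift_none.
rewrite scale0r add0r mulmx_sum_row.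
apply: eq_bigr => j _; rewrite mxE liftK; congr (_ *: _).
by apply/rowP => a; rewrite !mxE.
Qed.

End MinimalGenerators.

(** * Existence of minimal graded free resolutions *)

Section ResolutionExistence.

Variables (k : fieldType) (n : nat).
Local Notation P := {mpoly k[n]}.

(** The ambient rank is bundled with the submodule because it changes from one syzygy module to the
    next. *)
Record graded_sub := GradedSub {
  gs_rank : nat;
  gs_weight : 'I_gs_rank -> nat;
  gs_set : 'rV[P]_gs_rank -> Prop;
  gs_submod : submod gs_set;
  gs_graded : wgraded gs_weight gs_set
}.

Record min_cover (X : graded_sub) := MinCover {
  mc_rank : nat;
  mc_weight : 'I_mc_rank -> nat;
  mc_map : 'M[P]_(mc_rank, gs_rank X);
  mc_homog : whomog_rows (@gs_weight X) mc_map mc_weight;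
  mc_image : forall f, gs_set f <-> exists v, f = v *m mc_map;
  mc_minimal : forall (v : 'rV_mc_rank) i, v *m mc_map = 0 -> (v 0 i)@_0%MM = 0
}.

(** Minimality comes from taking the least number of homogeneous generators. The body [True] makes
    inhabitation a proposition, as the description axiom requires. *)
Lemma min_cover_ex X : exists c : min_cover X, True.
Proof.
have [q [D [w' [hD ND]]] qmin] :=
  nat_min (homogeneous_gens_ex (@gs_submod X) (@gs_graded X)).
by exists (MinCover hD ND (minimal_gens_kernel hD ND qmin)).
Qed.

Definition cover X : min_cover X :=
  sval (constructive_indefinite_description _ (min_cover_ex X)).

Definition syzygy X : graded_sub :=
  GradedSub (submod_kernel (mc_map (cover X)))
    (wgraded_kernel (@mc_homog _ (cover X))).

(** [X i] is the [i]-th syzygy module of [M], and [F_i] is the free module covering it. *)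
Definition cover_seq m (M : 'rV[P]_m -> Prop) (sM : submod M)
    (gM : wgraded (fun _ => 0%N) M) : free_seq k n m :=
  let X i := iter i syzygy (GradedSub sM gM) in
  @FreeSeq k n m (fun i => mc_rank (cover (X i)))
    (fun i a => (@mc_weight _ (cover (X i)) a)%:Z)
    (fun i => mc_map (cover (X i.+1))) (mc_map (cover (X 0%N))).

Lemma cover_seqP m (M : {pred 'rV[P]_m}) (sM : submod (fun f => f \in M))
    (gM : wgraded (fun _ => 0%N) (fun f => f \in M)) :
  graded_free_resolution M (cover_seq sM gM) /\ minimal (cover_seq sM gM).
Proof.
set X0 := GradedSub sM gM; pose X i := iter i syzygy X0.
have ker i (v : 'rV_(mc_rank (cover (X i)))) : v *m mc_map (cover (X i)) = 0 <->
    exists u, v = u *m mc_map (cover (X i.+1)).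
  exact: (@mc_image _ (cover (X i.+1))).
split; [split|].
- split=> [a b mu|i a b mu]; rewrite mcoeff_msupp => nz /=.
    have /= <- := @mc_homog _ (cover X0) a (mu, b).
      by rewrite /wdeg addn0.
    by rewrite /vcoef mxE.
  have /= <- := @mc_homog _ (cover (X i.+1)) a (mu, b); last first.
    by rewrite /vcoef mxE.
  by rewrite /wdeg /= addrC PoszD.
- exact: (@mc_image _ (cover X0)).
- exact: ker.
- by move=> i; apply: (ker i.+1).
(* The image of [diff F i] is the kernel of the minimal cover of [X i]. *)
move=> i v b; apply: (@mc_minimal _ (cover (X i))).
by apply/ker; exists v.
Qed.

End ResolutionExistence.

(** * The ideals [I_s] and their products with submodules *)

Section VariableIdeals.

Variables (k : fieldType) (n : nat).
Local Notation P := {mpoly k[n]}.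

(* f lies in I_s P^r.  As 'I_n starts at 0, I_s is generated by the 'X_i with
   i < s. *)
Definition inI (s r : nat) (f : 'rV[P]_r) : Prop :=
  forall t : term n r,
    (forall i : 'I_n, (i < s)%N -> t.1 i = 0%N) -> vcoef f t = 0.

(* f lies in I_s N, defined as the smallest submodule containing the
   generators. *)
Definition inIM (s r : nat) (N : 'rV[P]_r -> Prop) (f : 'rV[P]_r) : Prop :=
  forall S, submod S ->
    (forall (i : 'I_n) g, (i < s)%N -> N g -> S ('X_i *: g)) -> S f.

Lemma inIM_submod s r (N : 'rV[P]_r -> Prop) : submod (inIM s N).
Proof.
split=> [S [] //|p f g sf sg S sS NS].
by apply: sS.2; [apply: sf | apply: sg].
Qed.

Lemma inI_submod s r : submod (@inI s r).
Proof.
have D f g : @inI s r f -> inI s g -> inI s (f + g).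
  by move=> If Ig t t0; rewrite vcoefD If // Ig // addr0.
split=> [t _|p f g If Ig]; first exact: vcoef0.
apply: (D _ _ _ Ig); rewrite (mpolyE p) scaler_suml.
apply: (big_ind (@inI s r)); [by move=> t _; apply: vcoef0 | exact: D |].
move=> mu _ t t0; rewrite -mul_mpolyC -scalerA vcoefC.
have [/eqP ->|] := boolP (vcoef ('X_[mu] *: f) t == 0); first by rewrite mulr0.
case/vcoefXM_n0 => u Et; rewrite If ?eqxx // => i /t0.
by rewrite Et mnmDE => /eqP; rewrite addn_eq0 => /andP [_ /eqP].
Qed.

Lemma inI_X s r (i : 'I_n) (f : 'rV[P]_r) : (i < s)%N -> inI s ('X_i *: f).
Proof.
move=> lt_is t /(_ i lt_is) t0; apply/eqP/negPn/negP => /vcoefXM_n0 [u Et].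
by move: t0; rewrite Et mnmDE mnm1E eqxx.
Qed.

Lemma inIM_inI s r (N : 'rV[P]_r -> Prop) f : inIM s N f -> inI s f.
Proof. by apply; [apply: inI_submod | move=> i g lt_is _; apply: inI_X]. Qed.

Lemma inI_le s s' r (f : 'rV[P]_r) : (s <= s')%N -> inI s f -> inI s' f.
Proof. by move=> le If t t0; apply: If => i lt; apply/t0/leq_trans/le. Qed.

Lemma inI0 r (f : 'rV[P]_r) : inI 0 f <-> f = 0.
Proof.
split=> [If|-> t _]; last exact: vcoef0.
by apply: vcoefP => t; rewrite vcoef0 If.
Qed.

(** For [s <= i], multiplication by ['X_i] keeps a term free of the variables of [I_s], so the
    coefficients of [f] that must vanish are coefficients of ['X_i *: f]. *)
Lemma inI_regular s r (i : 'I_n) (f : 'rV[P]_r) :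
  (s <= i)%N -> inI s ('X_i *: f) -> inI s f.
Proof.
move=> le_si If t t0; rewrite -(vcoefXM U_(i)); apply: If => j lt_js.
rewrite mnmDE t0 // mnm1E addn0; case: eqP => // E.
by move: lt_js; rewrite -E ltnNge le_si.
Qed.

(** ['X_i *: u] collects the terms of [f] divisible by ['X_i]; every other term of [f] already
    involves a variable of [I_s]. *)
Lemma inI_split (s r : nat) (i : 'I_n) (f : 'rV[P]_r) :
  s = i -> inI s.+1 f -> exists u, inI s (f - 'X_i *: u).
Proof.
move=> Es If.
have [u uP] : exists u : 'rV[P]_r, forall t,
    vcoef ('X_i *: u) t = if t.1 i != 0%N then vcoef f t else 0.
  elim/rV_ind: f {If} => [|f g [u uP] [v vP]|c mu a].
  - by exists 0 => t; rewrite scaler0 vcoef0 if_same.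
  - exists (u + v) => t; rewrite scalerDr !vcoefD uP vP.
    by case: ifP; rewrite ?addr0.
  set x := 'X_[mu] *: delta_mx 0 a.
  have E t : vcoef x t != 0 -> t.1 = mu.
    case/vcoefXM_n0 => -[nu b] -> /=; rewrite /vcoef mxE eqxx /=.
    have [_|_] := eqVneq b a; last by rewrite mcoeff0 eqxx.
    by rewrite mcoeff1; have [->|_] := eqVneq nu 0%MM; rewrite ?addm0 ?eqxx.
  have [mi|mi] := boolP (mu i != 0%N).
    exists (c%:MP *: ('X_[mu - U_(i)] *: delta_mx 0 a)) => t.
    rewrite scalerA mulrC -scalerA ['X_i *: _]scalerA -mpolyXD addmC.
    rewrite submK ?lep1mP //.
    rewrite -/x !vcoefC; case: ifP => // ti.
    have [/eqP->|/E Et] := boolP (vcoef x t == 0).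
      by rewrite mulr0.
    by rewrite Et mi in ti.
  exists 0 => t; rewrite scaler0 vcoef0 vcoefC; case: ifP => // ti.
  have [/eqP->|/E Et] := boolP (vcoef x t == 0).
    by rewrite mulr0.
  by rewrite -Et ti in mi.
exists u => t t0; rewrite vcoefB uP; case: ifP => [_|/negbFE /eqP ti].
  by rewrite subrr.
rewrite subr0; apply: If => j; rewrite ltnS leq_eqVlt Es => /predU1P [E|lt].
  by rewrite (_ : j = i) //; apply: val_inj.
by apply: t0; rewrite Es.
Qed.

(** Splitting one variable at a time off [z] writes [z *m D] as a sum of elements ['X_i *: (v *m D)]
    with [i < s]. *)
Lemma inIM_mul s q r (N : 'rV[P]_r -> Prop) (D : 'M[P]_(q, r)) (z : 'rV[P]_q) :
  (s <= n)%N -> (forall v, N (v *m D)) -> inI s z -> inIM s N (z *m D).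
Proof.
move=> le_sn ND; elim: s z le_sn => [|s IH] z lt_sn Iz.
  by move/inI0: Iz => ->; rewrite mul0mx; case: (inIM_submod 0 N).
have [u Iu] := @inI_split s _ (Ordinal lt_sn) _ erefl Iz.
rewrite -[z](subrK ('X_(Ordinal lt_sn) *: u)) mulmxDl -scalemxAl.
apply: (submodD (inIM_submod _ _)).
  move=> S sS NS; apply: (IH _ (ltnW lt_sn) Iu S sS) => i g lt_is Ng.
  by apply: NS => //; apply: ltnW.
by move=> S sS NS; apply: NS.
Qed.

Lemma inI_mul s q r (D : 'M[P]_(q, r)) (z : 'rV[P]_q) :
  (s <= n)%N -> inI s z -> inI s (z *m D).
Proof.
move=> le_sn Iz; apply: (@inIM_inI _ _ (fun _ => True)).
exact: inIM_mul.
Qed.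

Lemma inIM_image s q r (N : 'rV[P]_r -> Prop) (D : 'M[P]_(q, r)) f :
  (forall g, N g -> exists v, g = v *m D) -> inIM s N f ->
  exists2 z : 'rV[P]_q, inI s z & f = z *m D.
Proof.
move=> ND /(_ (fun g => exists2 z : 'rV_q, inI s z & g = z *m D)); apply.
  split=> [|p g1 g2 [z1 I1 ->] [z2 I2 ->]].
    by exists 0; rewrite ?mul0mx //; case: (inI_submod s q).
  exists (p *: z1 + z2); last by rewrite mulmxDl scalemxAl.
  exact: (inI_submod s q).2.
move=> i g lt_is /ND [v ->]; exists ('X_i *: v); first exact: inI_X.
by rewrite scalemxAl.
Qed.

End VariableIdeals.

(* c is not neutral for minn, so the monoid lemmas on big operators do not
   apply here. *)
Lemma big_minn_le (T : eqType) (c : nat) (s : seq T) (Q : pred T) F x :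
  x \in s -> Q x -> (\big[minn/c]_(y <- s | Q y) F y <= F x)%N.
Proof.
elim: s => // y s IH; rewrite inE big_cons => /predU1P [<- ->|xs Qx].
  exact: geq_minl.
by case: ifP => _; rewrite ?geq_min IH // orbT.
Qed.

(** * Classes of exponents *)

Section Class.

Variable n : nat.
Implicit Types (mu : 'X_{1..n}).

Lemma cls_le mu (i : 'I_n) : mu i != 0%N -> (cls mu <= i.+1)%N.
Proof. by move=> mi; apply: big_minn_le; rewrite ?mem_index_enum. Qed.

Lemma cls_ge mu c : (c <= n)%N ->
  (forall i : 'I_n, mu i != 0%N -> (c <= i.+1)%N) -> (c <= cls mu)%N.
Proof.
move=> le_cn H; rewrite /cls; elim/big_ind: _ => //.
by move=> x y cx cy; rewrite leq_min cx.
Qed.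

Lemma cls_max mu : (cls mu <= n)%N.
Proof.
rewrite /cls; elim/big_ind: _ => // x y xn yn.
by rewrite geq_min xn.
Qed.

(** The bound is strict because [n] is also the class of [mu = 0], where no variable occurs. *)
Lemma cls_attained mu : (cls mu < n)%N ->
  exists2 i : 'I_n, mu i != 0%N & cls mu = i.+1.
Proof.
move=> lt_n; apply: NNPP => no.
suff: ((cls mu).+1 <= cls mu)%N by rewrite ltnn.
apply: cls_ge => // i mi; rewrite ltn_neqAle cls_le // andbT.
by apply/eqP => E; apply: no; exists i.
Qed.

End Class.

Lemma seq_argmax (T : eqType) (F : T -> nat) (x : T) (l : seq T) : x \in l ->
  exists2 y, y \in l & forall z, z \in l -> (F z <= F y)%N.
Proof.
elim: l x => // x0 l IH x _; case: l IH => [|x1 l] IH.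
  by exists x0 => [|z]; rewrite !inE // => /eqP ->.
have [y yl yP] := IH x1 (mem_head _ _).
have [le|lt] := leqP (F x0) (F y).
  exists y; first by rewrite inE yl orbT.
  by move=> z; rewrite inE => /predU1P [->|/yP].
exists x0; first exact: mem_head.
move=> z; rewrite inE => /predU1P [-> //|/yP H].
exact: leq_trans H (ltnW lt).
Qed.

(** * Regular sequence and socle element from a Pommaret basis *)

Section PommaretBasis.

Variables (k : fieldType) (n m : nat) (M : {pred 'rV[{mpoly k[n]}]_m}).
Variables (prec : rel (term n m)) (H : seq 'rV[{mpoly k[n]}]_m).
Hypothesis M_graded : graded_submodule M.
Hypothesis M_nonzero : exists2 f, f \in M & f != 0.
Hypothesis ord : term_order prec.
Hypothesis prec_class : class_respecting prec.
Hypothesis H_basis : pommaret_basis prec M H.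
Hypothesis H_homog : homogeneous_set H.

Local Notation d := (min_cls prec H).
Local Notation w0 := (fun _ : 'I_m => 0%N).
Local Notation Mset := (fun f => f \in M).

Lemma submod_pred : submod Mset.
Proof. by case: M_graded => -[M0 MD] _; split=> // p f g; apply: MD. Qed.

Lemma wgraded_pred : wgraded w0 Mset.
Proof.
case: M_graded => _ gM f fM e.
rewrite (_ : wcomp w0 e f = map_mx (pihomog mdeg e) f).
  exact: gM.
by apply/rowP => a; rewrite !mxE subn0.
Qed.

Lemma wdeg0 (t : term n m) : wdeg w0 t = tdeg t.
Proof. exact: addn0. Qed.

Lemma pb_div f t : f \in M -> is_lt prec f t ->
  exists h s rho, [/\ h \in H, is_lt prec h s, t = tmul rho s &
    forall j : 'I_n, (tcls s < j.+1)%N -> rho j = 0%N].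
Proof.
move=> fM lt_f; have nz : f != 0.
  by case: lt_f => nz _; apply: contraNneq nz => ->; rewrite vcoef0.
have [|h [s [hH /(lead_termP ord) hs [rho rhoP tE]]]] := (pb_cover H_basis t).1.
  by exists f; split=> //; apply/(lead_termP ord).
by exists h, s, rho.
Qed.

Lemma pb_inj h1 h2 s1 s2 t : h1 \in H -> h2 \in H -> is_lt prec h1 s1 ->
  is_lt prec h2 s2 -> pommaret_cone s1 t -> pommaret_cone s2 t -> h1 = h2.
Proof.
move=> H1 H2 /(lead_termP ord) l1 /(lead_termP ord) l2 c1 c2.
apply/eqP/negPn/negP => ne.
exact: (pb_disjoint H_basis H1 H2 ne l1 l2 (conj c1 c2)).
Qed.

Lemma pb_homog h s : h \in H -> is_lt prec h s -> whomog w0 (tdeg s) h.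
Proof.
move=> hH [nz _]; have [e he] := H_homog hH.
have whe : whomog w0 e h.
  move=> t ht; rewrite wdeg0; have /dhomogP := he t.2; apply.
  by rewrite mcoeff_msupp.
by rewrite -wdeg0 (whe _ nz).
Qed.

Lemma fclsE (h : 'rV[{mpoly k[n]}]_m) s :
  is_lt prec h s -> fcls prec h = tcls s.
Proof. by move/(lead_termP ord) => hs; rewrite /fcls hs. Qed.

Lemma min_cls_le h s : h \in H -> is_lt prec h s -> (d <= tcls s)%N.
Proof.
by move=> hH /fclsE <-; apply: big_minn_le.
Qed.

Lemma min_cls_leqn : (d <= n)%N.
Proof.
rewrite /min_cls; elim: (H) => [|h l IH]; rewrite ?big_nil // big_cons.
by rewrite geq_min IH orbT.
Qed.

Lemma min_cls_attained : exists h s, [/\ h \in H, is_lt prec h s & tcls s = d].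
Proof.
apply: NNPP => no.
have lt_d h s : h \in H -> is_lt prec h s -> (d < tcls s)%N.
  move=> hH hs; rewrite ltn_neqAle (min_cls_le hH hs) andbT.
  by apply/eqP => E; apply: no; exists h, s.
(* The starting value [n] of the minimum must exceed [d] as well; this uses an element of [H], which
   exists since [M] is non-zero. *)
have lt_dn : (d < n)%N.
  have [f fM nz] := M_nonzero; have [t ft] := is_lt_ex ord nz.
  have [h [s [_ [hH hs _ _]]]] := pb_div fM ft.
  exact: leq_trans (lt_d _ _ hH hs) (cls_max _).
suff: (d < d)%N by rewrite ltnn.
rewrite {2}/min_cls big_seq; elim/big_ind: _ => // [x y lx ly|h hH].
  by rewrite leq_min lx.
have [_ nz] := pb_sub H_basis hH; have [s hs] := is_lt_ex ord nz.
by rewrite (fclsE hs); apply: lt_d hs.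
Qed.

(** Each reduction step subtracts a multiple of some ['X_[rho] *: h]. This element lies in [I_s M]
    because [rho] involves a variable of [I_s], so the remainder is again in [I_s P^m], with smaller
    leading term. *)
Lemma inI_inIM s e :
  (forall h t, h \in H -> is_lt prec h t ->
    (s < tcls t)%N \/ tcls t = s /\ (tdeg t < e)%N) ->
  forall f, f \in M -> whomog w0 e f -> inI s f -> inIM s Mset f.
Proof.
move=> Hs f fM fe If; have [->|nz] := eqVneq f 0.
  by case: (inIM_submod s Mset).
have [t] := is_lt_ex ord nz.
elim/(well_founded_ind (prec_wf ord)): t f fM fe If {nz} => t IH f fM fe If ft.
have [h [u [rho [hH hu tE rhoP]]]] := pb_div fM ft.
(* If the class of [u] exceeds [s], then [u] is free of the variables of [I_s] while [t] is not. If
   it equals [s], then [rho] is non-zero for degree reasons and uses only multiplicative variables,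
   which are those of [I_s]. *)
have [i lt_is rho_i] : exists2 i : 'I_n, (i < s)%N & rho i != 0%N.
  case: (Hs h u hH hu) => [lt_su|[Eu lt_e]].
    apply: NNPP => no; have /eqP[] := ft.1; apply: If => i lt_is.
    rewrite tE mnmDE; apply/eqP; rewrite addn_eq0; apply/andP; split.
      by apply/negPn/negP => nz; apply: no; exists i.
    apply/negPn/negP => /cls_le; rewrite leqNgt.
    by rewrite (leq_trans _ lt_su) // ltnS.
  have nz : rho != 0%MM.
    apply/eqP => rho0; have := fe _ ft.1; rewrite wdeg0 tE rho0 tmul0 => E.
    by rewrite E ltnn in lt_e.
  apply: NNPP => no; case/eqP: nz; apply/mnmP => j; rewrite mnm0E.
  have [lt_js|le_sj] := ltnP j s; last by apply: rhoP; rewrite Eu ltnS.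
  by apply/eqP/negPn/negP => nz; apply: no; exists j.
pose g := 'X_[rho] *: h.
have Ig : inIM s Mset g.
  move=> S sS NS; rewrite /g -(submK (_ : U_(i) <= rho)%MM) ?lep1mP //.
  rewrite addmC mpolyXD -scalerA; apply: NS => //.
  by apply: submodZ submod_pred _; case: (pb_sub H_basis hH).
have ge : whomog w0 e g.
  have <- : (mdeg rho + tdeg u)%N = e.
    by rewrite -(fe _ ft.1) wdeg0 tE /tdeg /= mdegD.
  exact/whomogXM/pb_homog.
have gM : g \in M.
  by apply: submodZ submod_pred _; case: (pb_sub H_basis hH).
have gt : is_lt prec g t by rewrite tE; apply: is_ltXM.
have [c cP] := is_lt_cancel ft gt.
rewrite -[f](subrK (c%:MP *: g)).
apply: (submodD (inIM_submod _ _)); last exact: submodZ (inIM_submod _ _) Ig.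
have [->|nz] := eqVneq (f - c%:MP *: g) 0.
  by case: (inIM_submod s Mset).
have [t' ft'] := is_lt_ex ord nz.
apply: (IH t' (cP _ ft')) => //.
- by apply: (submodB submod_pred) => //; apply: submodZ submod_pred _.
- by apply: whomogB => //; apply: whomogC.
apply: (submodB (@inI_submod k n s m)) => //.
exact: submodZ (@inI_submod k n s m) (inIM_inI Ig).
Qed.

(** In P^m the variable ['X_i] cancels modulo [I_i]; as all classes in [H] exceed [i], [inI_inIM]
    then applies to each homogeneous component. *)
Lemma pommaret_regular (i : 'I_n) f : (i < d)%N -> f \in M ->
  inIM i Mset ('X_i *: f) -> inIM i Mset f.
Proof.
move=> lt_id fM /inIM_inI /(inI_regular (leqnn _)) If.
have [B ->] := wcomp_sum w0 f.
apply: (@submod_sum _ _ _ (inIM i Mset)) => [|e _]; first exact: inIM_submod.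
apply: (@inI_inIM i e) => [h t hH ht|||t t0].
- by left; apply: leq_trans (min_cls_le hH ht).
- exact: wgraded_pred.
- exact: wcomp_homog.
by rewrite vcoef_wcomp If // if_same.
Qed.

(* The witness is an element of H of class d and maximal degree. *)
Lemma pommaret_socle : exists f, [/\ f \in M, ~ inIM d Mset f &
  forall j : 'I_n, (d <= j)%N -> inIM d Mset ('X_j *: f)].
Proof.
have [h [s [hH hs sd hmax]]] : exists h s, [/\ h \in H, is_lt prec h s,
    tcls s = d & forall h' s', h' \in H -> is_lt prec h' s' -> tcls s' = d ->
      (tdeg s' <= tdeg s)%N].
  have [h0 [s0 [h0H hs0 s0d]]] := min_cls_attained.
  pose F (h : 'rV[{mpoly k[n]}]_m) := oapp (@tdeg n m) 0%N (lead_term prec h).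
  have [|h] := @seq_argmax _ F h0 [seq h <- H | fcls prec h == d].
    by rewrite mem_filter h0H (fclsE hs0) s0d eqxx.
  rewrite mem_filter => /andP [/eqP hd hH] hmax.
  have [_ nz] := pb_sub H_basis hH; have [s hs] := is_lt_ex ord nz.
  exists h, s; rewrite -(fclsE hs); split=> // h' s' h'H hs' s'd.
  have := hmax h'; rewrite mem_filter h'H (fclsE hs') s'd eqxx => /(_ isT).
  by rewrite /F ((lead_termP ord _ _).2 hs) ((lead_termP ord _ _).2 hs').
have [hM hnz] := pb_sub H_basis hH.
exists h; split=> //; last first.
  move=> j le_dj; have lt_dn := leq_ltn_trans le_dj (ltn_ord j).
  have fe := @whomogXM k n m w0 _ U_(j)%MM _ (pb_homog hH hs).
  have fl := is_ltXM ord U_(j)%MM hs.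
  (* By maximality of the degree of [h], elements of [H] of class [d] have degree below that of
     ['X_j *: h]. *)
  apply: inI_inIM (fe) _ => [h' t h'H ht'||].
  - have := min_cls_le h'H ht'; rewrite leq_eqVlt.
    case/predU1P => [E|]; last by left.
    by right; split=> //; rewrite mdeg1 ltnS (hmax h').
  - exact: submodZ submod_pred hM.
  (* A term outside [I_d P^m] would have class above [d], hence would exceed the leading term, which
     has the same degree and class at most [d]. *)
  move=> t t0; apply/eqP/negPn/negP => nz.
  have cls_t : (d < tcls t)%N.
    apply: cls_ge => // i; apply: contraR; rewrite -ltnNge ltnS => lt_id.
    by apply/eqP/t0.
  have cls_l : (tcls (tmul U_(j)%MM s) <= d)%N.
    have [|i si Es] := @cls_attained _ s.1; first by rewrite -/(tcls s) sd.
    rewrite -sd {2}/tcls Es; apply: cls_le.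
    by rewrite mnmDE addn_eq0 negb_and si orbT.
  have lt_cls := leq_ltn_trans cls_l cls_t.
  have E : tdeg (tmul U_(j)%MM s) = tdeg t.
    by rewrite -!wdeg0 (fe _ nz) (fe _ fl.1).
  have := prec_class E lt_cls; have [Et|ne] := eqVneq t (tmul U_(j)%MM s).
    by rewrite Et (prec_irr ord).
  by move/(prec_asym ord (fl.2 _ nz ne)).
move=> hI; have [d0|d_gt0] := posnP d.
  by have := inIM_inI hI; rewrite d0 => /inI0 /eqP; rewrite (negPf hnz).
have lt_d'n : (d.-1 < n)%N by rewrite prednK // min_cls_leqn.
pose i0 := Ordinal lt_d'n; have Ei0 : i0.+1 = d by rewrite /= prednK.
have free_s (i : 'I_n) : (i < i0)%N -> s.1 i = 0%N.
  move=> lt; apply/eqP/negPn/negP => /cls_le.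
  by rewrite -/(tcls s) sd -Ei0 leqNgt ltnS lt.
(* Only the last variable ['X_i0] of [I_d] survives modulo [I_i0]. *)
have [p pM Ip] : exists2 p, p \in M & inI i0 (h - 'X_i0 *: p).
  apply: (hI (fun f => exists2 p, p \in M & inI i0 (f - 'X_i0 *: p))).
    split=> [|c f g [p pM Ip] [q qM Iq]].
      exists 0; first exact: submod_pred.1.
      by rewrite scaler0 subr0; case: (@inI_submod k n i0 m).
    exists (c *: p + q); first by apply: submod_pred.2.
    rewrite scalerDr opprD addrACA scalerA mulrC -scalerA -scalerBr.
    exact: (@inI_submod k n i0 m).2.
  move=> i g; rewrite -Ei0 ltnS leq_eqVlt => /predU1P [E|lt] gM.
    exists g => //; rewrite (_ : i = i0) ?subrr; last exact: val_inj.
    by case: (@inI_submod k n i0 m).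
  exists 0; first by case: submod_pred.
  by rewrite scaler0 subr0; apply: inI_X.
have [u su _] : exists2 u, s = tmul U_(i0)%MM u & vcoef p u != 0.
  apply: vcoefXM_n0; apply: contraNneq hs.1 => E.
  by have := Ip s free_s; rewrite vcoefB E subr0 => ->.
have hh := pb_homog hH hs.
have Es : tdeg s = (mdeg U_(i0)%MM + tdeg u)%N by rewrite su /tdeg /= mdegD.
(* Passing to one degree makes the class respecting property applicable to the terms of [q]. *)
pose q := wcomp w0 (tdeg u) p.
have qM : q \in M by apply: wgraded_pred.
have Iq : inI i0 (h - 'X_i0 *: q).
  move=> t t0; have := Ip t t0; rewrite !vcoefB /q -wcompXM -Es vcoef_wcomp.
  case: eqP => // ne E; rewrite subr0; apply/eqP/negPn/negP.
  by move/hh.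
have hq (t : term n m) : (forall i : 'I_n, (i < i0)%N -> t.1 i = 0%N) ->
    vcoef h (tmul U_(i0)%MM t) = vcoef q t.
  move=> t0; apply/eqP.
  rewrite -subr_eq0 -[vcoef q t](vcoefXM U_(i0)%MM) -vcoefB.
  apply/eqP/Iq => i lt; rewrite mnmDE t0 // mnm1E addn0.
  by case: eqP => // E; rewrite -E ltnn in lt.
have free_u (i : 'I_n) : (i < i0)%N -> u.1 i = 0%N.
  by move/free_s; rewrite su mnmDE => /eqP; rewrite addn_eq0 => /andP [_ /eqP].
have qu : vcoef q u != 0 by rewrite -hq // -su; case: hs.
have qnz : q != 0 by apply: contraNneq qu => ->; rewrite vcoef0.
have [t qt] := is_lt_ex ord qnz.
(* Otherwise [t] would have smaller class than [u] and thus be smaller, although it is the leading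
   term of [q]. *)
have free_t (i : 'I_n) : (i < i0)%N -> t.1 i = 0%N.
  move=> lt; apply/eqP/negPn/negP => ti.
  have lt_cls : (tcls t < tcls u)%N.
    apply: leq_trans (_ : i0.+1 <= _)%N.
      by rewrite ltnS; apply: leq_trans (cls_le ti) lt.
    apply: cls_ge => // j; apply: contraR; rewrite -ltnNge ltnS => lt_j.
    by apply/eqP/free_u.
  have E : tdeg t = tdeg u.
    by rewrite -!wdeg0 !(@wcomp_homog _ _ _ w0 (tdeg u) p) //; case: qt.
  have := prec_class E lt_cls; have [Eu|ne] := eqVneq u t.
    by rewrite Eu (prec_irr ord).
  by move/(prec_asym ord (qt.2 _ qu ne)).
(* If [u] were below [t], then ['X_i0] times [t] would occur in [h] above its leading term [s]. *)
have Eut : u = t.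
  apply/eqP/negPn/negP => ne; have := prec_mul ord U_(i0)%MM (qt.2 _ qu ne).
  rewrite -su => lt; have ht : vcoef h (tmul U_(i0)%MM t) != 0.
    by rewrite hq //; case: qt.
  have [E|ne'] := eqVneq (tmul U_(i0)%MM t) s.
    by rewrite E (prec_irr ord) in lt.
  by case: (prec_asym ord lt (hs.2 _ ht ne')).
(* Since [d <= tcls s'], the variable ['X_i0] is multiplicative for [s'], so [s] lies in the cone of
   [s'] as well as in its own. Disjointness gives [h' = h], yet [s'] has smaller degree than [s]. *)
have [h' [s' [rho [h'H hs' tE rhoP]]]] := pb_div qM qt.
have Eh : h' = h.
  apply: (pb_inj (t := s) h'H hH hs' hs).
    exists (U_(i0) + rho)%MM; last by rewrite su Eut tE /tmul /= addmA.
    move=> j lt; rewrite mnmDE rhoP // addn0 mnm1E; case: eqP => // E.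
    by have := min_cls_le h'H hs'; rewrite leqNgt -Ei0 {1}E lt.
  by exists 0%MM; rewrite ?tmul0 // => j _; rewrite mnm0E.
have : tdeg s = (mdeg U_(i0)%MM + (mdeg rho + tdeg s'))%N.
  by rewrite Es Eut tE /tdeg /= mdegD.
rewrite (is_lt_uniq ord (_ : is_lt prec h s') hs) -?Eh // mdeg1 add1n.
by move/eqP; rewrite eqn_leq ltnNge leq_addl andbF.
Qed.

End PommaretBasis.

(** * Length of a minimal resolution, by adding one variable at a time *)

Section ResolutionLength.

Variables (k : fieldType) (n m : nat) (M : {pred 'rV[{mpoly k[n]}]_m}).
Variables (F : free_seq k n m) (d : nat).
Hypothesis F_res : graded_free_resolution M F.
Hypothesis F_min : minimal F.
Hypothesis le_dn : (d <= n)%N.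

Local Notation Mset := (fun f => f \in M).

Hypothesis M_regular : forall (i : 'I_n) f, (i < d)%N -> f \in M ->
  inIM i Mset ('X_i *: f) -> inIM i Mset f.
Hypothesis M_socle : exists f, [/\ f \in M, ~ inIM d Mset f &
  forall j : 'I_n, (d <= j)%N -> inIM d Mset ('X_j *: f)].

Lemma res_imageP f : f \in M -> exists v : 'rV_(rank F 0), f = v *m aug F.
Proof. by move/(res_image F_res). Qed.

Lemma aug_in (v : 'rV_(rank F 0)) : v *m aug F \in M.
Proof. by apply/(res_image F_res); exists v. Qed.

Lemma diff_aug (w : 'rV_(rank F 1)) : w *m diff F 0 *m aug F = 0.
Proof. by apply/(res_exact0 F_res); exists w. Qed.

Lemma diff_diff i (w : 'rV_(rank F i.+2)) : w *m diff F i.+1 *m diff F i = 0.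
Proof. by apply/(res_exactS F_res); exists w. Qed.

Lemma inI_add_X (s r : nat) (i : 'I_n) (f g : 'rV[{mpoly k[n]}]_r) :
  s = i -> inI s (f - 'X_i *: g) -> inI s.+1 f.
Proof.
move=> Es If; rewrite -[f](subrK ('X_i *: g)).
apply: (submodD (@inI_submod k n s.+1 r)); first exact: inI_le If.
by apply: inI_X; rewrite Es.
Qed.

(* Exactness of F / I_s F at F_(i+1). *)
Lemma exact_mod s i (v : 'rV_(rank F i.+1)) : (s <= n)%N -> (s <= d + i)%N ->
  inI s (v *m diff F i) ->
  exists w : 'rV_(rank F i.+2), inI s (v - w *m diff F i.+1).
Proof.
elim: s i v => [|s IH] i v le_sn le_si.
  by move/inI0/(res_exactS F_res) => [w ->]; exists w; apply/inI0/subrr.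
pose x := Ordinal le_sn; move=> Iv.
have [u Iu] := @inI_split k n s _ x _ erefl Iv.
have {}Iu : inI s ('X_x *: u - v *m diff F i).
  by rewrite -opprB -scaleN1r; apply: submodZ (@inI_submod _ _ _ _) Iu.
(* Modulo [I_s], regularity of ['X_x] makes [u] a cycle, and exactness one place lower makes it a
   boundary. At [i = 0] the place below is [M] itself, where [M_regular] is used. *)
have [w Iw] : exists w : 'rV_(rank F i.+1), inI s (u - w *m diff F i).
  case: i v u le_si {Iv} Iu => [|i] v u le_si Iu.
    have E : 'X_x *: (u *m aug F) = ('X_x *: u - v *m diff F 0) *m aug F.
      by rewrite mulmxBl diff_aug subr0 scalemxAl.
    have /(inIM_image res_imageP) [z Iz uz] : inIM x Mset (u *m aug F).
      apply: M_regular; [by rewrite addn0 in le_si | exact: aug_in |].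
      by rewrite E; apply: (inIM_mul (ltnW le_sn) aug_in Iu).
    have /(res_exact0 F_res) [w Ew] : (u - z) *m aug F = 0.
      by rewrite mulmxBl uz subrr.
    by exists w; rewrite -Ew opprB addrC subrK.
  apply: IH; [exact: ltnW | by rewrite addnS ltnS in le_si |].
  apply: (@inI_regular _ _ s _ x) => //.
  have -> : 'X_x *: (u *m diff F i) =
      ('X_x *: u - v *m diff F i.+1) *m diff F i.
    by rewrite mulmxBl diff_diff subr0 scalemxAl.
  exact: inI_mul (ltnW le_sn) Iu.
(* Correcting [v] by ['X_x *: w] turns a cycle modulo [I_(s+1)] into one modulo [I_s]. *)
have [|y Iy] := IH i (v - 'X_x *: w) (ltnW le_sn) (ltnW le_si).
  have -> : (v - 'X_x *: w) *m diff F i =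
      'X_x *: (u - w *m diff F i) - ('X_x *: u - v *m diff F i).
    by rewrite mulmxBl -scalemxAl scalerBr opprB [RHS]addrC addrA subrK.
  apply: (submodB (@inI_submod _ _ _ _)) => //.
  exact: submodZ (@inI_submod _ _ _ _) Iw.
exists y; apply: (@inI_add_X s _ x _ w) => //.
by rewrite addrAC.
Qed.

(** By minimality every differential vanishes modulo [I_n], so by exactness a basis vector of
    [F_(i+1)] would lie in [I_n F_(i+1)], although it has the coefficient 1. *)
Lemma rank_vanish i : (n <= d + i)%N -> rank F i.+1 = 0%N.
Proof.
move=> le_n.
have min_inI j (v : 'rV_(rank F j.+1)) : inI n (v *m diff F j).
  move=> [mu a] mu0; rewrite /vcoef /= (_ : mu = 0%MM) ?F_min //.
  by apply/mnmP => l; rewrite mnm0E mu0.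
apply/eqP; rewrite -leqn0 leqNgt; apply/negP => lt0.
pose a := Ordinal lt0; pose v : 'rV[{mpoly k[n]}]_(rank F i.+1) := delta_mx 0 a.
have [w Iw] := @exact_mod n i v (leqnn n) le_n (min_inI _ v).
have: inI n v.
  rewrite -[v](subrK (w *m diff F i.+1)).
  by apply: (submodD (@inI_submod _ _ _ _)) => //; apply: min_inI.
move/(_ (0%MM, a)); rewrite /vcoef mxE !eqxx /= mcoeff1 eqxx => H.
by have /eqP := H (fun i _ => mnm0E i); rewrite oner_eq0.
Qed.

(* Multiplying a socle element by x_(s+1) and lifting through the differential
   moves it one step up the resolution. *)
Lemma socle_mod i : (d + i <= n)%N -> exists v : 'rV_(rank F i),
  (forall w, ~ inI (d + i) (v - w *m diff F i)) /\
  forall j : 'I_n, (d + i <= j)%N ->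
    exists w, inI (d + i) ('X_j *: v - w *m diff F i).
Proof.
elim: i => [|i IH] le_n.
  rewrite addn0; have [f [fM nf socf]] := M_socle.
  have [v fv] := res_imageP fM; exists v; split=> [w Iw|j le_dj].
    apply: nf; rewrite fv -[_ *m _]subr0 -(diff_aug w) -mulmxBl.
    exact: inIM_mul le_dn aug_in Iw.
  have [z Iz Ez] := inIM_image res_imageP (socf j le_dj).
  have /(res_exact0 F_res) [w Ew] : ('X_j *: v - z) *m aug F = 0.
    by rewrite mulmxBl -scalemxAl -fv Ez subrr.
  by exists w; rewrite -Ew opprB addrC subrK.
rewrite addnS in le_n *; set s := (d + i)%N in le_n IH *.
have [v [nv socv]] := IH (ltnW le_n); pose x := Ordinal le_n.
(* The new element [w] lifts ['X_x *: v] through the differential modulo [I_s]. *)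
have [w Iw] := socv x (leqnn _); exists w; split=> [y Iy|j lt_sj].
  (* If [w] were a boundary modulo [I_(s+1)], cancelling ['X_x] would make [v] a boundary modulo
     [I_s]. *)
  have [b Ib] := @inI_split k n s _ x _ erefl Iy.
  apply: (nv b); apply: (@inI_regular _ _ s _ x) => //.
  have -> : 'X_x *: (v - b *m diff F i) = ('X_x *: v - w *m diff F i) +
      (w - y *m diff F i.+1 - 'X_x *: b) *m diff F i.
    by rewrite !mulmxBl diff_diff subr0 -scalemxAl addrA subrK -scalerBr.
  apply: (submodD (@inI_submod _ _ _ _)) => //.
  exact: inI_mul (ltnW le_n) Ib.
have [wj Iwj] := socv j (ltnW lt_sj).
(* Both ['X_j *: w] and ['X_x *: wj] lift ['X_j] times ['X_x] times [v], so their difference is a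
   cycle modulo [I_s]; the second vanishes modulo [I_(s+1)]. *)
have [||y Iy] := @exact_mod s i ('X_j *: w - 'X_x *: wj) (ltnW le_n).
- exact: leqnn.
- have -> : ('X_j *: w - 'X_x *: wj) *m diff F i =
      'X_x *: ('X_j *: v - wj *m diff F i) -
      'X_j *: ('X_x *: v - w *m diff F i).
    rewrite mulmxBl -!scalemxAl !scalerBr !scalerA ['X_x * _]mulrC opprB.
    by rewrite [RHS]addrC addrA subrK.
  apply: (submodB (@inI_submod _ _ _ _)).
    exact: submodZ (@inI_submod _ _ _ _) Iwj.
  exact: submodZ (@inI_submod _ _ _ _) Iw.
exists y; apply: (@inI_add_X s _ x _ wj) => //.
by rewrite addrAC.
Qed.

Lemma res_length_eq : res_length F (n - d).
Proof.
split; last first.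
  by case=> // i lt_i; apply: rank_vanish; rewrite -leq_subLR.
have [|v [nv _]] := @socle_mod (n - d); first by rewrite subnKC.
(* With rank 0 there are no coefficients, so [inI] would hold vacuously, against [nv]. *)
rewrite lt0n; apply/eqP => r0; apply: (nv 0) => -[mu a].
by have := ltn_ord a; rewrite {2}r0.
Qed.

End ResolutionLength.

Theorem theorem8p8 (k : fieldType) (n m : nat)
    (M : {pred 'rV[{mpoly k[n]}]_m})
    (M_graded : graded_submodule M)
    (M_nonzero : exists2 f, f \in M & f != 0)
    (prec : rel (term n m))
    (prec_order : term_order prec)
    (prec_class : class_respecting prec)
    (H : seq 'rV[{mpoly k[n]}]_m)
    (H_basis : pommaret_basis prec M H)
    (H_homog : homogeneous_set H)
    (d : nat)
    (d_def : d = min_cls prec H) :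
  proj_dim M (n - d)%N.
Proof.
rewrite d_def {d d_def}; split.
  exists (cover_seq (submod_pred M_graded) (wgraded_pred M_graded)).
  exact: cover_seqP.
move=> F F_res F_min; apply: (res_length_eq F_res F_min).
- exact: min_cls_leqn.
- exact: pommaret_regular.
- exact: pommaret_socle.
Qed.
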